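(* Let $m\geq 1$ and $p_0\geq 4$ be integers. Then the Bahri–Xu inequality $\mathrm{BX}(p,m)$ holds for every $4\leq p\leq p_0$ if and only if for every $4\leq p\leq p_0$ and all distinct $y_1,\dots,y_p\in\mathbb S^m$, the system of equations $$\sum_{j\neq i}\frac{y_i-y_j}{|y_i-y_j|^3}\,v_j=0,\quad 1\leq i\leq p,$$ in the unknowns $(v_1,\dots,v_p)\in\mathbb R^p$ has no non-zero solution.
   Context: $|\cdot|$ is the Euclidean norm and $\mathbb S^m$ is the unit sphere in $\mathbb R^{m+1}$. For integers $p\geq 2$, $m\geq 1$, the Bahri–Xu inequality $\mathrm{BX}(p,m)$ (the Bahri–Xu conjecture for $p$ points in $\mathbb R^m$) is the assertion: there is a constant $c(p,m)>0$, depending only on $p$ and $m$, such that for all distinct $x_1,\dots,x_p\in\mathbb R^m$ and all $U=(u_1,\dots,u_p)^{\mathrm T}\in\mathbb R^p$, $$\sum_{1\leq i\leq p}\Big|\sum_{j\neq i}\frac{u_j}{|x_i-x_j|}\Big|^2+2\sup_{1\leq i\leq p}\Big|\sum_{j\neq i}u_i\frac{x_i-x_j}{|x_i-x_j|^3}u_j\Big|\;\geq\; c(p,m)\sum_{\substack{1\leq i,j\leq p\\ j\neq i}}\frac{u_j^2}{|x_i-x_j|^2}.$$ *)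

(* Defs.v *)
(* Points of R^m are row vectors ['rV[R]_m] over an arbitrary [R : realType];
   [BX_inequality R p m] is the Bahri-Xu inequality for p points in R^m. *)
From mathcomp Require Import all_boot all_order all_algebra.
From mathcomp Require Import classical_sets reals.

Set Implicit Arguments.
Unset Strict Implicit.
Unset Printing Implicit Defensive.

Import Order.TTheory GRing.Theory Num.Theory.

Local Open Scope classical_set_scope.
Local Open Scope ring_scope.

(* The library norm on matrices is the sup norm, hence this definition. *)
Definition enorm (R : realType) (n : nat) (x : 'rV[R]_n) : R :=
  Num.sqrt (\sum_(k < n) x 0 k ^+ 2).

Definition unit_sphere (R : realType) (m : nat) : set 'rV[R]_m.+1 :=
  [set y | enorm y = 1].

Definition BX_inequality (R : realType) (p m : nat) : Prop :=
  exists2 c : R, 0 < c &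
    forall x : 'I_p -> 'rV[R]_m, injective x -> forall u : 'cV[R]_p,
      \sum_(i < p) `| \sum_(j < p | j != i) u j 0 / enorm (x i - x j) | ^+ 2
      + 2 * sup (range (fun i : 'I_p =>
          enorm (\sum_(j < p | j != i)
            (u i 0 * u j 0 / enorm (x i - x j) ^+ 3) *: (x i - x j))))
      >= c * \sum_(i < p) \sum_(j < p | j != i)
               u j 0 ^+ 2 / enorm (x i - x j) ^+ 2.

Definition sphere_system (R : realType) (p m : nat)
    (y : 'I_p -> 'rV[R]_m.+1) (v : 'cV[R]_p) : Prop :=
  forall i : 'I_p,
    \sum_(j < p | j != i) (v j 0 / enorm (y i - y j) ^+ 3) *: (y i - y j) = 0.

Arguments unit_sphere : clear implicits.
Arguments BX_inequality : clear implicits.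

(* Main.v *)
(* Stereographic projection is conformal: a solution [v] of the system at points
   [y_i = stereo (z_i)] of the sphere corresponds to weights [u_i = conf (z_i) v_i]
   in R^m with zero potentials [\sum_j u_j / |z_i - z_j|] and zero forces
   [\sum_j u_j (z_i - z_j) / |z_i - z_j|^3], that is, to the vanishing of the
   left-hand side of the Bahri-Xu inequality; after a reflection no [y_i] is the
   pole.

   Conversely, suppose that the Bahri-Xu inequality fails along a sequence of
   configurations. With [d_i] the distance from [x_i] to its nearest neighbour and
   [W_i = u_i / d_i], normalised, all the quantities in play are bounded and
   converge along an ultrafilter. Call two points close when their distance is
   comparable to both of their [d]'s. A cluster of mutually close points, rescaled,
   converges to distinct points; points outside of it contribute a constant [t] to
   the limit potentials and nothing to the limit forces. Such a limit is a solution
   on the sphere, with weight [- t] at the pole, supported where the weights do not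
   vanish, so the weights of clusters with at least two points tend to 0. Among the
   other points with a nonzero limit weight, take [j] with [d_j] minimal: comparing
   the potentials at [j] and at its nearest neighbour shows that [W_j] tends to 0
   as well, which contradicts the normalisation. *)
Require Import Defs.
From mathcomp Require Import all_boot all_order all_algebra.
From mathcomp Require Import classical_sets reals.
From mathcomp Require Import boolp filter topology normedtype sequences realfun.
From mathcomp Require Import ring lra.

Set Implicit Arguments.
Unset Strict Implicit.
Unset Printing Implicit Defensive.

Import Order.TTheory GRing.Theory Num.Theory numFieldNormedType.Exports.

Local Open Scope classical_set_scope.
Local Open Scope ring_scope.

(** * Euclidean inner product and norm *)

Definition dotv (R : realType) (n : nat) (x y : 'rV[R]_n) : R :=
  \sum_(k < n) x 0 k * y 0 k.

Section Euclid.
Variables (R : realType) (n : nat).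
Implicit Types (x y z : 'rV[R]_n) (a : R).

Lemma dotvC x y : dotv x y = dotv y x.
Proof. by apply: eq_bigr => k _; rewrite mulrC. Qed.

Lemma dotvDl x y z : dotv (x + y) z = dotv x z + dotv y z.
Proof. by rewrite -big_split; apply: eq_bigr => k _; rewrite mxE mulrDl. Qed.

Lemma dotvZl a x y : dotv (a *: x) y = a * dotv x y.
Proof. by rewrite mulr_sumr; apply: eq_bigr => k _; rewrite mxE mulrA. Qed.

Lemma dotvNl x y : dotv (- x) y = - dotv x y.
Proof. by rewrite -scaleN1r dotvZl mulN1r. Qed.

Lemma dotv0l x : dotv 0 x = 0.
Proof. by rewrite -(scale0r x) dotvZl mul0r. Qed.

Lemma dotv0r x : dotv x 0 = 0.
Proof. by rewrite dotvC dotv0l. Qed.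

Lemma dotvDr x y z : dotv x (y + z) = dotv x y + dotv x z.
Proof. by rewrite dotvC dotvDl !(dotvC _ x). Qed.

Lemma dotvZr a x y : dotv x (a *: y) = a * dotv x y.
Proof. by rewrite dotvC dotvZl dotvC. Qed.

Lemma dotvNr x y : dotv x (- y) = - dotv x y.
Proof. by rewrite dotvC dotvNl dotvC. Qed.

Lemma dotv_sumr (I : finType) (P : pred I) x (f : I -> 'rV[R]_n) :
  dotv x (\sum_(i | P i) f i) = \sum_(i | P i) dotv x (f i).
Proof.
rewrite /dotv exchange_big /=; apply: eq_bigr => k _.
by rewrite summxE mulr_sumr.
Qed.

Definition dotvE := (dotvDl, dotvDr, dotvNl, dotvNr, dotvZl, dotvZr).

Lemma dotvv_ge0 x : 0 <= dotv x x.
Proof. by apply: sumr_ge0 => k _; rewrite -expr2 sqr_ge0. Qed.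

Lemma enorm_sqr x : enorm x ^+ 2 = dotv x x.
Proof.
rewrite /enorm sqr_sqrtr; last by apply: sumr_ge0 => k _; exact: sqr_ge0.
by apply: eq_bigr => k _; rewrite expr2.
Qed.

Lemma enorm_ge0 x : 0 <= enorm x.
Proof. exact: sqrtr_ge0. Qed.

Lemma enormE x : enorm x = Num.sqrt (dotv x x).
Proof. by rewrite -enorm_sqr sqrtr_sqr ger0_norm ?enorm_ge0. Qed.

Lemma enorm0_eq0 x : (enorm x == 0) = (x == 0).
Proof.
apply/idP/eqP => [|->]; last first.
  by rewrite /enorm big1 ?sqrtr0// => k _; rewrite mxE expr0n.
rewrite sqrtr_eq0 => h; apply/rowP => k; rewrite mxE.
have /psumr_eq0P H : forall k, true -> 0 <= x 0 k ^+ 2 by move=> *; apply: sqr_ge0.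
apply/eqP; rewrite -sqrf_eq0; apply/eqP; apply: H => //.
by apply/eqP; rewrite eq_le h sumr_ge0// => i _; exact: sqr_ge0.
Qed.

Lemma enorm_gt0 x : (0 < enorm x) = (x != 0).
Proof. by rewrite lt_neqAle enorm_ge0 andbT eq_sym enorm0_eq0. Qed.

Lemma enorm0 : enorm (0 : 'rV[R]_n) = 0.
Proof. by apply/eqP; rewrite enorm0_eq0. Qed.

Lemma enormZ a x : enorm (a *: x) = `|a| * enorm x.
Proof.
by rewrite !enormE !dotvE mulrA -expr2 sqrtrM ?sqr_ge0// sqrtr_sqr.
Qed.

Lemma enormN x : enorm (- x) = enorm x.
Proof. by rewrite -scaleN1r enormZ normrN1 mul1r. Qed.

Lemma enormB x y : enorm (x - y) = enorm (y - x).
Proof. by rewrite -enormN opprB. Qed.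

Lemma dotv_le_enorm x y : dotv x y <= enorm x * enorm y.
Proof.
have [->|y0] := eqVneq y 0.
  by rewrite enorm0 mulr0 /dotv big1// => k _; rewrite mxE mulr0.
have ny : 0 < enorm y by rewrite enorm_gt0.
have := dotvv_ge0 (enorm y ^+ 2 *: x - dotv x y *: y).
rewrite !dotvE -!enorm_sqr (dotvC y x) => h.
apply: le_trans (ler_norm _) _.
rewrite -(@ler_pXn2r _ 2) ?nnegrE// ?mulr_ge0 ?enorm_ge0// real_normK ?num_real//.
have : 0 <= enorm y ^+ 2 * ((enorm x * enorm y) ^+ 2 - dotv x y ^+ 2).
  by move: h; congr (_ <= _); ring.
by rewrite pmulr_rge0 ?exprn_gt0// subr_ge0.
Qed.

Lemma ler_enormD x y : enorm (x + y) <= enorm x + enorm y.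
Proof.
rewrite -(@ler_pXn2r _ 2) ?nnegrE ?addr_ge0 ?enorm_ge0//.
rewrite sqrrD !enorm_sqr !dotvE (dotvC y x).
by have := dotv_le_enorm x y; lra.
Qed.

Lemma ler_enormB y x z : enorm (x - z) <= enorm (x - y) + enorm (y - z).
Proof. by rewrite (le_trans _ (ler_enormD _ _))// addrA subrK. Qed.

Lemma coord_le_enorm x k : `|x 0 k| <= enorm x.
Proof.
rewrite -sqrtr_sqr ler_wsqrtr// (bigD1 k)//= lerDl sumr_ge0// => i _.
exact: sqr_ge0.
Qed.

End Euclid.

(** * Forces and potentials of weighted points *)

Section Force.
Variables (R : realType) (n : nat) (T : finType).
Variables (y : T -> 'rV[R]_n) (v : T -> R).

(** The index type is an arbitrary finite type because a point at infinity is added later, with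
    indices in [option T]. Terms with [y i = y j] vanish, since the inverse of 0 is 0. *)
Definition force (i : T) : 'rV[R]_n :=
  \sum_(j | j != i) (v j / enorm (y i - y j) ^+ 3) *: (y i - y j).

Definition potential (i : T) : R :=
  \sum_(j | j != i) v j / enorm (y i - y j).

(** Action and reaction: the term of the pair [(i, j)] is opposite to that of [(j, i)]. *)
Lemma sum_scale_force : \sum_i v i *: force i = 0.
Proof.
pose g i j := (v i * v j / enorm (y i - y j) ^+ 3) *: (y i - y j).
have gC i j : g j i = - g i j.
  by rewrite /g enormB (mulrC (v j)) -scalerN opprB.
have -> : \sum_i v i *: force i = \sum_i \sum_j g i j.
  apply: eq_bigr => i _; rewrite scaler_sumr [RHS](bigD1 i)//=.
  rewrite {1}/g subrr scaler0 add0r; apply: eq_bigr => j _.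
  by rewrite scalerA mulrA.
set S := (X in X = 0).
have SN : S = - S.
  by rewrite /S {1}exchange_big -sumrN; apply: eq_bigr => i _;
     rewrite -sumrN; apply: eq_bigr => j _; rewrite gC.
apply/eqP; have : S + S == 0 by rewrite {1}SN addNr.
by rewrite -mulr2n -scaler_nat scaler_eq0 pnatr_eq0.
Qed.

(* On the unit sphere [y_i . (y_i - y_j) = |y_i - y_j|^2 / 2]. *)
Lemma dotv_force i : (forall j, enorm (y j) = 1) ->
  dotv (y i) (force i) = potential i / 2.
Proof.
move=> y1; rewrite dotv_sumr mulr_suml; apply: eq_bigr => j _.
have [->|r0] := eqVneq (enorm (y i - y j)) 0.
  by rewrite dotvZr expr0n/= invr0 !mulr0 !mul0r.
have -> : dotv (y i) ((v j / enorm (y i - y j) ^+ 3) *: (y i - y j)) =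
   (v j / enorm (y i - y j) ^+ 3) * dotv (y i) (y i - y j) by rewrite dotvZr.
have -> : dotv (y i) (y i - y j) = enorm (y i - y j) ^+ 2 / 2.
  have := enorm_sqr (y i); have := enorm_sqr (y j).
  rewrite !y1 enorm_sqr !dotvE (dotvC (y j) (y i)) => <- <-.
  by field.
by field.
Qed.

End Force.

(** * Supports of solutions on the sphere *)

Section SphereSupport.
Variables (R : realType) (m : nat).

Definition no_sphere_solution (p : nat) : Prop :=
  forall y : 'I_p -> 'rV[R]_m.+1,
    (forall i : 'I_p, unit_sphere R m (y i)) -> injective y ->
    ~ (exists v : 'cV[R]_p, v <> 0 /\ sphere_system y v).

(** Pairing the equation at [k] with [y k] gives zero potentials. Their matrix is symmetric with
    zero diagonal and positive entries elsewhere; its determinant is [- a ^+ 2] for two points and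
    [2 * a * b * c] for three. *)
Lemma no_sphere_solution_small (p : nat) :
  (2 <= p <= 3)%N -> no_sphere_solution p.
Proof.
move=> p23 y y1 yI [v [v0 sv]]; apply: v0; apply/colP => i; rewrite mxE.
have pot k : \sum_j (if j != k then v j 0 / enorm (y k - y j) else 0) = 0.
  rewrite -big_mkcond -/(potential y (fun i => v i 0) k).
  have := @dotv_force _ _ _ y (fun i => v i 0) k y1.
  have -> : force y (fun i => v i 0) k = 0 by exact: sv.
  rewrite dotv0r => /esym/eqP.
  by rewrite mulf_eq0 invr_eq0 pnatr_eq0 orbF => /eqP.
have rp j k : j != k -> 0 < (enorm (y j - y k))^-1.
  by move=> jk; rewrite invr_gt0 enorm_gt0 subr_eq0 (inj_eq yI).
have : p = 2%N \/ p = 3%N.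
  by case: p p23 {y y1 yI v sv i pot rp} => [|[|[|[|]]]]//; [left|right].
case=> E; subst p.
  have := pot ord0; have := pot (lift ord0 ord0).
  rewrite !big_ord_recl !big_ord0 /= !addr0 !add0r.
  have := rp ord0 (lift ord0 ord0) isT; have := rp (lift ord0 ord0) ord0 isT.
  move=> /gt_eqF a /gt_eqF b /eqP + /eqP.
  rewrite !mulf_eq0 a b !orbF => /eqP c /eqP d.
  by case: (unliftP ord0 i) => [j|] ->//; rewrite (ord1 j).
have := pot ord0; have := pot (lift ord0 ord0); have := pot (lift ord0 (lift ord0 ord0)).
rewrite !big_ord_recl !big_ord0 /= !addr0 !add0r.
set o0 := @ord0 2; set o1 : 'I_3 := lift ord0 ord0.
set o2 : 'I_3 := lift ord0 (lift ord0 ord0).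
have [d01 d12 d02] : [/\ o0 != o1, o1 != o2 & o0 != o2] by [].
rewrite (enormB (y o2) (y o0)) (enormB (y o2) (y o1)) (enormB (y o1) (y o0)).
have := rp _ _ d01; have := rp _ _ d02; have := rp _ _ d12.
set a := (_)^-1; set b := (_)^-1; set c := (_)^-1 => a0 b0 c0.
move=> e2 e1 e0.
(* The combination with coefficients [p], [q], [- r] eliminates [x1] and [x2]. *)
have solve (p q r x1 x2 x3 : R) : 0 < p -> 0 < q -> 0 < r ->
    x2 * r + x3 * q = 0 -> x1 * r + x3 * p = 0 -> x1 * q + x2 * p = 0 -> x3 = 0.
  move=> p0 q0 r0 h1 h2 h3; have : 2 * p * q * x3 = 0.
    transitivity (p * (x2 * r + x3 * q) + q * (x1 * r + x3 * p)
                  - r * (x1 * q + x2 * p)); first by ring.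
    by rewrite h1 h2 h3 !mulr0 addr0 subr0.
  by move=> /eqP; rewrite !mulf_eq0 pnatr_eq0 (gt_eqF p0) (gt_eqF q0) => /eqP.
have v2 : v o2 0 = 0 by apply: (solve _ _ _ (v o0 0) (v o1 0)) e0 e1 e2.
have v1 : v o1 0 = 0.
  by apply: (solve _ _ _ (v o0 0) (v o2 0) _ a0 c0 b0) => //; rewrite addrC.
have v0 : v o0 0 = 0.
  by apply: (solve _ _ _ (v o1 0) (v o2 0) _ b0 c0 a0) => //; rewrite addrC.
case: (unliftP ord0 i) => [j|] ->//; case: (unliftP ord0 j) => [k|] ->//.
by rewrite (ord1 k).
Qed.

(** Dropping the points of weight 0 leaves a solution on [#|S|] distinct points with no zero weight,
    which is excluded from two points on. The equation at [i0] follows from the others by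
    [sum_scale_force]; in the application [i0] is the pole. *)
Lemma support_le1 (p0 : nat) (T : finType) (y : T -> 'rV[R]_m.+1) (v : T -> R)
    (i0 : T) (S := [set i | v i != 0]%SET) :
  (forall p, (4 <= p <= p0)%N -> no_sphere_solution p) ->
  (forall i, enorm (y i) = 1) -> {in S &, injective y} ->
  (forall i, i != i0 -> v i != 0 -> force y v i = 0) ->
  (#|S| <= p0)%N -> (#|S| <= 1)%N.
Proof.
move=> H y1 yI f0 Sp0; rewrite leqNgt; apply/negP => S1.
have f0' i : v i != 0 -> force y v i = 0.
  have [->{i} vi0|] := eqVneq i i0; last exact: f0.
  have := sum_scale_force y v; rewrite (bigD1 i0)//= big1 ?addr0.
    by move/eqP; rewrite scaler_eq0 (negbTE vi0) => /eqP.
  by move=> i ii0; have [->|/f0->//] := eqVneq (v i) 0; rewrite ?scale0r ?scaler0.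
have HS : no_sphere_solution #|S|.
  have [S4|S4] := leqP 4 #|S|; first by apply: H; rewrite S4.
  by apply: no_sphere_solution_small; rewrite S1.
have vn0 (k : 'I_#|S|) : v (enum_val k) != 0.
  by have := enum_valP k; rewrite inE.
apply: (HS (y \o enum_val)) => [i|i j /= yij|].
- exact: y1.
- by apply/enum_val_inj/yI => //; apply: enum_valP.
exists (\col_k v (enum_val k)); split.
  move=> /colP/(_ (Ordinal (ltnW S1))); rewrite !mxE => /eqP.
  by rewrite (negbTE (vn0 _)).
move=> i; transitivity (force y v (enum_val i)); last exact: f0'.
rewrite /force.
rewrite [RHS](bigID (mem S))/= [X in _ = _ + X]big1 ?addr0.
  rewrite [RHS](eq_bigl (fun j => (j \in S) && (j != enum_val i))); last first.
    by move=> j; exact: andbC.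
  rewrite [RHS]big_enum_val_cond/=; apply: eq_big => [k|k _]; last by rewrite mxE.
  by rewrite (inj_eq enum_val_inj).
by move=> j /andP[_]; rewrite inE negbK => /eqP->; rewrite mul0r scale0r.
Qed.

End SphereSupport.

(** * Stereographic projection *)

Section Stereographic.
Variables (R : realType) (m : nat).
Implicit Types z : 'rV[R]_m.

Definition pole : 'rV[R]_m.+1 := \row_k (k == ord0)%:R.

Definition hyperplane z : 'rV[R]_m.+1 :=
  \row_k oapp (fun l => z 0 l) 0 (unlift ord0 k).

(** The inversion with centre [pole] and squared radius 2, restricted to the hyperplane; [conf z]
    below is the distance from [hyperplane z] to the centre. *)
Definition stereo z : 'rV[R]_m.+1 :=
  pole + (2 / (1 + enorm z ^+ 2)) *: (hyperplane z - pole).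

Definition conf z : R := Num.sqrt (1 + enorm z ^+ 2).

Lemma hyperplaneD z z' : hyperplane (z + z') = hyperplane z + hyperplane z'.
Proof.
by apply/rowP => k; rewrite !mxE; case: unlift => [l|]/=; rewrite ?mxE ?addr0.
Qed.

Lemma hyperplaneZ a z : hyperplane (a *: z) = a *: hyperplane z.
Proof.
by apply/rowP => k; rewrite !mxE; case: unlift => [l|]/=; rewrite ?mxE ?mulr0.
Qed.

Lemma hyperplane0 : hyperplane 0 = 0.
Proof. by rewrite -(scale0r 0) hyperplaneZ scale0r. Qed.

Lemma hyperplane_sum (I : finType) (P : pred I) (f : I -> 'rV[R]_m) :
  hyperplane (\sum_(i | P i) f i) = \sum_(i | P i) hyperplane (f i).
Proof. exact: (big_morph _ hyperplaneD hyperplane0). Qed.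

Lemma hyperplaneB z z' : hyperplane (z - z') = hyperplane z - hyperplane z'.
Proof. by rewrite -scaleN1r hyperplaneD hyperplaneZ scaleN1r. Qed.

Lemma dotv_hyperplane z z' : dotv (hyperplane z) (hyperplane z') = dotv z z'.
Proof.
rewrite /dotv big_ord_recl !mxE unlift_none/= mul0r add0r.
by apply: eq_bigr => k _; rewrite !mxE liftK.
Qed.

Lemma dotv_pole x : dotv pole x = x 0 ord0.
Proof.
rewrite /dotv big_ord_recl !mxE eqxx mul1r big1 ?addr0// => k _.
by rewrite !mxE mul0r.
Qed.

Lemma pole_hyperplane z : dotv pole (hyperplane z) = 0.
Proof. by rewrite dotv_pole mxE unlift_none. Qed.

Lemma pole_pole : dotv pole pole = 1.
Proof. by rewrite dotv_pole mxE eqxx. Qed.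

Lemma enorm_pole : enorm pole = 1.
Proof. by rewrite enormE pole_pole sqrtr1. Qed.

Lemma enorm_hyperplane z : enorm (hyperplane z) = enorm z.
Proof. by rewrite !enormE dotv_hyperplane. Qed.

Lemma hyperplane_eq0 z : (hyperplane z == 0) = (z == 0).
Proof. by rewrite -enorm0_eq0 enorm_hyperplane enorm0_eq0. Qed.

Lemma conf_arg_gt0 z : 0 < 1 + enorm z ^+ 2.
Proof. by rewrite ltr_pwDl// sqr_ge0. Qed.

Lemma conf_gt0 z : 0 < conf z.
Proof. by rewrite sqrtr_gt0 conf_arg_gt0. Qed.

Lemma conf_sqr z : conf z ^+ 2 = 1 + enorm z ^+ 2.
Proof. by rewrite sqr_sqrtr// ltW// conf_arg_gt0. Qed.

Lemma stereoE z :
  stereo z = pole + (2 / conf z ^+ 2) *: (hyperplane z - pole).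
Proof. by rewrite conf_sqr. Qed.

Definition dot_simpl :=
  (dotvE, pole_hyperplane, pole_pole, dotv_hyperplane,
   fun z => etrans (dotvC (hyperplane z) pole) (pole_hyperplane z)).

Lemma enorm_stereo z : enorm (stereo z) = 1.
Proof.
rewrite enormE -[RHS]sqrtr1; congr Num.sqrt.
rewrite stereoE !dot_simpl -enorm_sqr.
have -> : enorm z ^+ 2 = conf z ^+ 2 - 1 by rewrite conf_sqr addrC addKr.
by field; rewrite gt_eqF// conf_gt0.
Qed.

Lemma enorm_stereo_pole z : enorm (stereo z - pole) = 2 / conf z.
Proof.
rewrite stereoE addrC addKr enormZ ger0_norm ?divr_ge0 ?sqr_ge0//.
have -> : enorm (hyperplane z - pole) = conf z.
  by rewrite enormE /conf enorm_sqr; congr Num.sqrt; rewrite !dot_simpl; ring.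
by field; rewrite gt_eqF// conf_gt0.
Qed.

Lemma enorm_stereoB z z' :
  enorm (stereo z - stereo z') = 2 * enorm (z - z') / (conf z * conf z').
Proof.
have [c0 c0'] := (conf_gt0 z, conf_gt0 z').
have p : 0 <= 2 * enorm (z - z') / (conf z * conf z').
  by rewrite divr_ge0 ?mulr_ge0 ?enorm_ge0 ?ltW.
apply/eqP; rewrite -(@eqrXn2 _ 2)// ?enorm_ge0//; apply/eqP.
rewrite enorm_sqr !stereoE !dot_simpl exprMn exprMn enorm_sqr !dot_simpl.
rewrite (dotvC z' z) -!enorm_sqr.
have -> : enorm z ^+ 2 = conf z ^+ 2 - 1 by rewrite conf_sqr addrC addKr.
have -> : enorm z' ^+ 2 = conf z' ^+ 2 - 1 by rewrite conf_sqr addrC addKr.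
by field; rewrite !gt_eqF.
Qed.

Lemma stereo_inj : injective stereo.
Proof.
move=> z z' /eqP; rewrite -subr_eq0 -enorm0_eq0 enorm_stereoB.
rewrite !mulf_eq0 invr_eq0 mulf_eq0 !(gt_eqF (conf_gt0 _)) pnatr_eq0 /= !orbF.
by rewrite enorm0_eq0 subr_eq0 => /eqP.
Qed.

Lemma stereo_neq_pole z : stereo z != pole.
Proof.
by rewrite -subr_eq0 -enorm0_eq0 enorm_stereo_pole gt_eqF// divr_gt0 ?conf_gt0.
Qed.

Lemma stereo_surj y : enorm y = 1 -> y != pole -> exists z, y = stereo z.
Proof.
move=> y1 yN; pose s := y 0 ord0.
pose w := \row_k y 0 (lift ord0 k).
have yE : y = s *: pole + hyperplane w.
  apply/rowP => k; rewrite !mxE; case: unliftP => [l|] -> /=.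
    by rewrite mxE mulr0 add0r.
  by rewrite mulr1 addr0.
have ws : enorm w ^+ 2 = 1 - s ^+ 2.
  have := enorm_sqr y; rewrite y1 [in RHS]yE !dot_simpl -enorm_sqr expr1n => ->.
  by ring.
have s1 : 1 - s != 0.
  apply: contra yN; rewrite subr_eq0 => /eqP es.
  move: ws; rewrite -es expr1n subrr => /eqP; rewrite sqrf_eq0 enorm0_eq0 => /eqP w0.
  by rewrite yE -es w0 hyperplane0 addr0 scale1r.
(* The line through [pole] and [y] meets the hyperplane here. *)
exists ((1 - s)^-1 *: w).
have c : 1 + enorm ((1 - s)^-1 *: w) ^+ 2 = 2 / (1 - s).
  by rewrite enormZ exprMn real_normK ?num_real// ws; field.
rewrite /stereo c yE hyperplaneZ scalerBr addrCA scalerA.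
have -> : 2 / (2 / (1 - s)) = 1 - s by field.
by rewrite mulfV// scale1r addrC scalerBl scale1r opprB addrCA subrr addr0.
Qed.

(* [stereo] is a Moebius map with conformal factor [2 / conf ^+ 2]: weights
   scale by [conf], and the forces on the sphere combine those in the
   hyperplane with the potentials. *)
Lemma force_stereo (T : finType) (z : T -> 'rV[R]_m) (u : T -> R) (i : T) :
  force (stereo \o z) (fun j => u j / conf (z j)) i =
  (conf (z i) / 4) *: (conf (z i) ^+ 2 *: hyperplane (force z u i)
    + (potential z u i - 2 * dotv (z i) (force z u i)) *: (hyperplane (z i) - pole)).
Proof.
rewrite /potential dotv_sumr mulr_sumr -sumrB hyperplane_sum scaler_sumr.
rewrite scaler_suml -big_split/= scaler_sumr; apply: eq_bigr => j _.
rewrite /= enorm_stereoB hyperplaneZ dotvZr.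
have [ci cj] := (conf_gt0 (z i), conf_gt0 (z j)).
have [->|r0] := eqVneq (enorm (z i - z j)) 0.
  rewrite mulr0 mul0r !expr0n/= !invr0 !mulr0 mul0r mulr0 subr0.
  by rewrite !scale0r scaler0 addr0 scaler0.
(* Expand the norm of [z j = z i - (z i - z j)]. The difference of the squared [conf] is also the
   coefficient of [hyperplane (z i) - pole] in [stereo (z i) - stereo (z j)], up to a factor. *)
have e : conf (z j) ^+ 2 = conf (z i) ^+ 2 + enorm (z i - z j) ^+ 2
    - 2 * dotv (z i) (z i - z j).
  rewrite !conf_sqr !enorm_sqr !dotvE (dotvC (z j) (z i)); ring.
have -> : u j / enorm (z i - z j) -
    2 * (u j / enorm (z i - z j) ^+ 3 * dotv (z i) (z i - z j)) =
    u j / enorm (z i - z j) ^+ 3 * (conf (z j) ^+ 2 - conf (z i) ^+ 2).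
  rewrite e; field; exact: r0.
rewrite /= !stereoE hyperplaneB.
set N := pole; set Z := hyperplane _; set Z' := hyperplane _.
apply/rowP => k; rewrite !mxE.
by field; rewrite r0 !gt_eqF.
Qed.

(** The force in the hyperplane is orthogonal to [pole], so the component along [pole] isolates the
    scalar coefficient in [force_stereo]. Once this is 0, the force vanishes, and then the
    potential. *)
Lemma force_stereo_eq0 (T : finType) (z : T -> 'rV[R]_m) (u : T -> R) (i : T) :
  force (stereo \o z) (fun j => u j / conf (z j)) i = 0 ->
  force z u i = 0 /\ potential z u i = 0.
Proof.
rewrite force_stereo => /eqP; have ci := conf_gt0 (z i).
rewrite scaler_eq0 mulf_eq0 gt_eqF//= invr_eq0 pnatr_eq0/= => /eqP e.
have e1 : potential z u i = 2 * dotv (z i) (force z u i).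
  have := congr1 (dotv pole) e.
  rewrite !dot_simpl dotv0r mulr0 add0r sub0r mulrN1 => /eqP.
  by rewrite oppr_eq0 subr_eq0 => /eqP.
move: e; rewrite e1 subrr scale0r addr0 => /eqP.
rewrite scaler_eq0 sqrf_eq0 gt_eqF//= hyperplane_eq0 => /eqP f0.
by rewrite f0 dotv0r mulr0.
Qed.

End Stereographic.

(** * Equilibria with a constant potential *)

Section Cluster.
Variables (R : realType) (m : nat).

(* A nonzero constant potential [t] is the contribution of one more point at
   infinity, that is, of the pole of the sphere with weight [- t]. *)
Lemma cluster_weights_eq0 (p0 : nat) (T : finType) (z : T -> 'rV[R]_m)
    (u : T -> R) (t : R) (E : {set T}) :
  (forall p, (4 <= p <= p0)%N -> no_sphere_solution R m p) ->
  {in E &, injective z} -> (forall j, j \notin E -> u j = 0) ->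
  (forall i, i \in E -> potential z u i = t) ->
  (forall i, i \in E -> u i != 0 -> force z u i = 0) ->
  (#|E| + (t != 0%R) <= p0)%N -> (1 < #|E|)%N -> forall i, u i = 0.
Proof.
move=> H zI uE pot frc Ep E1.
pose y := oapp (@stereo R m \o z) (pole R m).
pose v := oapp (fun j => u j / conf (z j)) (- t).
have [i0 [i1 [i0E i1E i01]]] : exists i j, [/\ i \in E, j \in E & i != j].
  by move/card_gt1P: E1 => [i [j [? ? ?]]]; exists i, j.
have conf0 j : conf (z j) != 0 by rewrite gt_eqF// conf_gt0.
have vSome j : (v (Some j) != 0) = (u j != 0).
  by rewrite /v/= mulf_eq0 invr_eq0 (negbTE (conf0 j)) orbF.
have inE' j : u j != 0 -> j \in E by apply: contraNT => /uE ->.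
have S1 : (#|[set i | v i != 0%R]%SET| <= 1)%N.
  apply: (@support_le1 R m p0 _ y v None) => //.
  - by move=> [j|]/=; [exact: enorm_stereo | exact: enorm_pole].
  - move=> [i|] [j|]; rewrite !inE ?vSome//= => ui uj.
    + by move=> /stereo_inj/(zI _ _ (inE' _ ui) (inE' _ uj)) ->.
    + by move=> /eqP; rewrite (negbTE (stereo_neq_pole _)).
    + by move=> /esym/eqP; rewrite (negbTE (stereo_neq_pole _)).
  - move=> [i|]// _; rewrite vSome => ui; have iE := inE' _ ui.
    rewrite /force (bigD1 None)//=.
    rewrite (reindex_omap Some id)/=; last by case.
    rewrite (eq_bigl (fun j => j != i)); last first.
      by move=> j; rewrite eqxx andbT andbT (inj_eq Some_inj).
    have := force_stereo z u i; rewrite /force/= => ->.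
    (* What is left is a multiple of [hyperplane (z i) - pole]: the potential [t] gives
       [t * conf (z i) / 4], and the pole of weight [- t] gives the opposite. *)
    rewrite -!/(force z u i) frc// pot// enorm_stereo_pole stereoE.
    rewrite dotv0r hyperplane0 scaler0 add0r mulr0 subr0 scalerA.
    rewrite (addrC (pole R m)) addrK.
    rewrite scalerA -scalerDl.
    by rewrite [X in X *: _](_ : _ = 0) ?scale0r//; field.
  - have sub : [set i | v i != 0%R]%SET \subset
       (if t != 0 then None |: [set Some j | j in E]%SET
        else [set Some j | j in E]%SET).
      apply/fintype.subsetP => -[j|]; rewrite inE ?vSome.
        by move=> /inE' jE; case: ifP; rewrite ?inE/= imset_f.
      by rewrite /v/= oppr_eq0 => t0; rewrite t0 !inE eqxx.
    apply: leq_trans (subset_leq_card sub) _; apply: leq_trans Ep.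
    case: ifP => _; last by rewrite card_imset ?addn0//; exact: Some_inj.
    rewrite cardsU1 card_imset; last exact: Some_inj.
    by rewrite addnC leq_add2l leq_b1.
have one i j : v i != 0 -> v j != 0 -> i = j.
  by move=> vi vj; apply: (card_le1_eqP S1); rewrite inE.
(* If the pole carries the only nonzero weight, all [u j] vanish, and so does their potential
   [t]. *)
have t0 : t = 0.
  apply/eqP; apply: contraT => tn0.
  have vN : v None != 0 by rewrite /v/= oppr_eq0.
  have u0 j : u j = 0.
    apply/eqP; apply: contraT; rewrite -vSome => /(one _ _ vN) //.
  by case/eqP: tn0; rewrite -(pot _ i0E) /potential big1// => j _; rewrite u0 mul0r.
(* A single nonzero [u i] would have a nonzero potential at any other point [k] of [E]. *)
move=> i; apply/eqP; apply: contraT => ui; have iE := inE' _ ui.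
have [k kE ki] : exists2 k, k \in E & k != i.
  by have [ii0|] := eqVneq i0 i; [exists i1; rewrite // -ii0 eq_sym | exists i0].
have := pot _ kE.
rewrite /potential (bigD1 i) 1?eq_sym//= big1 ?addr0 => [|j /andP[_ ji]].
  move=> /eqP; rewrite t0 mulf_eq0 (negbTE ui) invr_eq0 enorm0_eq0 subr_eq0/=.
  move=> /eqP/(zI _ _ kE iE) e.
  by rewrite e eqxx in ki.
suff -> : u j = 0 by rewrite mul0r.
apply/eqP; apply: contraT => uj.
have /Some_inj e : Some j = Some i by apply: one; rewrite vSome.
by rewrite e eqxx in ji.
Qed.

End Cluster.

(** * From the inequality to the sphere *)

Section BXToSphere.
Variables (R : realType) (m : nat).

(* The Householder reflection exchanging [x] and [y]. *)
Lemma exists_reflection (n : nat) (x y : 'rV[R]_n) :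
  enorm x = 1 -> enorm y = 1 ->
  exists2 M : 'M[R]_n, (forall a : 'rV[R]_n, enorm (a *m M) = enorm a) &
    x *m M = y.
Proof.
move=> x1 y1; pose h := x - y.
pose M : 'M[R]_n := 1%:M - (2 / dotv h h) *: (h^T *m h).
have ME (a : 'rV[R]_n) : a *m M = a - (2 * dotv a h / dotv h h) *: h.
  rewrite mulmxBr mulmx1 -scalemxAr mulmxA; congr (_ - _).
  rewrite (mx11_scalar (a *m h^T)) mul_scalar_mx scalerA mulrAC; congr (_ * _ *: _).
  by congr (_ * _); rewrite mxE; apply: eq_bigr => k _; rewrite mxE.
have [h0|h0] := eqVneq h 0.
  exists M => [a|]; rewrite ME h0 scaler0 subr0//.
  by apply/eqP; rewrite -subr_eq0 -/h h0.
have hh : dotv h h != 0 by rewrite -enorm_sqr sqrf_eq0 enorm0_eq0.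
exists M => [a|]; rewrite ME.
  have expand (b : 'rV[R]_n) k : dotv (a - k *: b) (a - k *: b) =
      dotv a a - 2 * k * dotv a b + k ^+ 2 * dotv b b.
    by rewrite !dotvE (dotvC b a); ring.
  by rewrite !enormE expand; congr Num.sqrt; field.
have e : dotv h h = 2 * dotv x h.
  have := enorm_sqr x; have := enorm_sqr y.
  by rewrite x1 y1 /h !dotvE (dotvC y x) expr1n => <- <-; ring.
by rewrite -e mulfV// scale1r opprB addrC subrK.
Qed.

(** Pigeonhole on [p + 1] distinct points of the sphere, the images of constant vectors; these
    vectors differ because [m] is positive. *)
Lemma exists_sphere_avoiding (p : nat) (y : 'I_p -> 'rV[R]_m.+1) :
  (0 < m)%N -> exists2 x : 'rV[R]_m.+1, enorm x = 1 & forall i, y i != x.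
Proof.
move=> m0; pose f (k : 'I_p.+1) := stereo (const_mx k%:R : 'rV[R]_m).
have fI : injective f.
  move=> k l /stereo_inj /rowP/(_ (Ordinal m0)); rewrite !mxE => /eqP.
  by rewrite eqr_nat => /eqP/val_inj.
have [/forallP H|] := boolP [forall k, [exists i, y i == f k]]; last first.
  rewrite negb_forall => /existsP[k]; rewrite negb_exists => /forallP H.
  by exists (f k); [exact: enorm_stereo | exact: H].
have [g gE] : exists g : 'I_p.+1 -> 'I_p, forall k, y (g k) = f k.
  apply: (@fin_all_exists _ (fun=> 'I_p) (fun k i => y i = f k)) => k.
  by have /existsP[i /eqP] := H k; exists i.
have gI : injective g by move=> k l e; apply: fI; rewrite -!gE e.
by have := leq_card g gI; rewrite !card_ord ltnn.
Qed.

Lemma no_sphere_solution_of_BX (p : nat) : (0 < m)%N -> (1 < p)%N ->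
  BX_inequality R p m -> no_sphere_solution R m p.
Proof.
move=> m0 p1 [c c0 BX] y y1 yI [v [v0 sv]]; apply: v0.
have [P P1 yP] := exists_sphere_avoiding y m0.
have [M Miso PM] := exists_reflection P1 (enorm_pole R m).
have MI : injective (fun a : 'rV[R]_m.+1 => a *m M).
  move=> a b /eqP; rewrite -subr_eq0 -mulmxBl -enorm0_eq0 Miso enorm0_eq0.
  by rewrite subr_eq0 => /eqP.
have [z zE] : exists z : 'I_p -> 'rV[R]_m, forall i, y i *m M = stereo (z i).
  apply: (@fin_all_exists _ (fun=> 'rV[R]_m) (fun i z =>
    y i *m M = stereo z)) => i; apply: stereo_surj.
    by rewrite Miso; exact: y1.
  by rewrite -PM (inj_eq MI).
have zI : injective z.
  by move=> i j e; apply/yI/MI; rewrite /= !zE e.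
pose u j := conf (z j) * v j 0.
have [fz pz] : (forall i, force z u i = 0) /\ (forall i, potential z u i = 0).
  apply/all_and2 => i; apply: force_stereo_eq0.
  rewrite -(mul0mx _ M) -(sv i) mulmx_suml; apply: eq_bigr => j _.
  rewrite -scalemxAl mulmxBl !zE /= -!zE -mulmxBl Miso; congr (_ / _ *: _).
  by rewrite /u mulrAC mulfV ?mul1r// gt_eqF// conf_gt0.
have := BX z zI (\col_j u j).
rewrite [X in _ <= X + _]big1 => [|i _]; last first.
  have := pz i; rewrite /potential => pzi.
  by under eq_bigr do rewrite mxE; rewrite pzi normr0 expr0n.
have -> : range (fun i : 'I_p => enorm (\sum_(j < p | j != i)
    ((\col_j u j) i 0 * (\col_j u j) j 0 / enorm (z i - z j) ^+ 3)
    *: (z i - z j))) = [set 0].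
  have e i : enorm (\sum_(j < p | j != i)
    ((\col_j u j) i 0 * (\col_j u j) j 0 / enorm (z i - z j) ^+ 3)
    *: (z i - z j)) = 0.
    apply/eqP; rewrite enorm0_eq0; apply/eqP.
    transitivity (u i *: force z u i); last by rewrite fz scaler0.
    rewrite scaler_sumr; apply: eq_bigr => j _.
    by rewrite !mxE scalerA mulrA.
  apply/seteqP; split => [x [i _ <-]|x ->]; first exact: e.
  by exists (Ordinal (ltnW p1)).
rewrite sup1 mulr0 addr0 pmulr_rle0// => le0.
have ge0 (i j : 'I_p) : 0 <= (\col_j u j) j 0 ^+ 2 / enorm (z i - z j) ^+ 2.
  by rewrite divr_ge0 ?sqr_ge0.
have sge0 (i : 'I_p) :
    0 <= \sum_(j < p | j != i) (\col_j u j) j 0 ^+ 2 / enorm (z i - z j) ^+ 2.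
  by apply: sumr_ge0.
have /psumr_eq0P s0 : \sum_(i < p) \sum_(j < p | j != i)
    (\col_j u j) j 0 ^+ 2 / enorm (z i - z j) ^+ 2 = 0.
  by apply/eqP; rewrite eq_le le0 sumr_ge0.
apply/colP => j; rewrite mxE.
(* The weight at [j] occurs on the right-hand side of the inequality only through some other point
   [i]. *)
have [i ij] : exists i : 'I_p, i != j.
  have [->|n0] := eqVneq j (Ordinal (ltnW p1)); first by exists (Ordinal p1).
  by exists (Ordinal (ltnW p1)); rewrite eq_sym.
have /psumr_eq0P : \sum_(j < p | j != i)
    (\col_j u j) j 0 ^+ 2 / enorm (z i - z j) ^+ 2 = 0.
  exact: s0.
move=> /(_ (fun j _ => ge0 i j))/(_ j); rewrite eq_sym => /(_ ij)/eqP.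
rewrite mxE mulf_eq0 invr_eq0 !sqrf_eq0 enorm0_eq0 subr_eq0 (inj_eq zI) (negbTE ij) orbF.
by rewrite mulf_eq0 gt_eqF ?conf_gt0//= => /eqP.
Qed.

End BXToSphere.

(** * Normalised near-counterexamples *)

Section AlmostNull.
Variables (R : realType) (p m : nat).

(* [s i] is a nearest neighbour of [i], at distance [d_i], and [W i] is
   [u_i / d_i], normalised; in these terms every coefficient is at most 1
   in absolute value. *)
Definition almost_null (c : R) (x : 'I_p -> 'rV[R]_m) (s : 'I_p -> 'I_p)
    (W : 'I_p -> R) (d := fun i => enorm (x i - x (s i))) : Prop :=
  [/\ injective x,
      forall i j, j != i -> d i <= enorm (x i - x j),
      forall i, s i != i,
      \sum_i W i ^+ 2 = 1 &
      (forall i, `|\sum_(j | j != i) W j * (d j / enorm (x i - x j))| <= c) /\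
      (forall i k, `|W i * \sum_(j | j != i)
         W j * (d i * d j / enorm (x i - x j) ^+ 3 * (x i - x j) 0 k)| <= c)].

Lemma almost_null_le1 (c : R) x s W i : almost_null c x s W -> `|W i| <= 1.
Proof.
case=> _ _ _ W1 _; rewrite -sqrtr_sqr -[leRHS]sqrtr1 ler_wsqrtr// -W1.
by rewrite (bigD1 i)//= lerDl sumr_ge0// => j _; exact: sqr_ge0.
Qed.

Lemma exists_nearest (x : 'I_p -> 'rV[R]_m) : (1 < p)%N ->
  exists s : 'I_p -> 'I_p, (forall i, s i != i) /\
    forall i j, j != i -> enorm (x i - x (s i)) <= enorm (x i - x j).
Proof.
move=> p1; have ex i : exists j : 'I_p, j != i.
  have [->|n0] := eqVneq i (Ordinal (ltnW p1)); first by exists (Ordinal p1).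
  by exists (Ordinal (ltnW p1)); rewrite eq_sym.
have [s sP] : exists s : 'I_p -> 'I_p, forall i, s i != i /\
    forall j, j != i -> enorm (x i - x (s i)) <= enorm (x i - x j).
  apply: (@fin_all_exists _ (fun=> 'I_p) (fun i k => k != i /\
    forall j, j != i -> enorm (x i - x k) <= enorm (x i - x j))) => i.
  have [j0 j0i] := ex i.
  by case: (@Order.TotalTheory.arg_minP _ R _ j0 (fun j => j != i)
    (fun j => enorm (x i - x j)) j0i) => k ki kmin; exists k.
by exists s; split => i; have [] := sP i.
Qed.

Lemma exists_almost_null : (1 < p)%N -> ~ BX_inequality R p m ->
  forall c : R, 0 < c -> exists x s W, almost_null c x s W.
Proof.
move=> p1 nBX c c0.
have p_gt0 : 0 < p%:R :> R by rewrite ltr0n ltnW.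
(* All distances from [x j] are at least [d j], so the right-hand sum is at most [p] times [q], the
   sum of the squares of [u j / d j]. Dividing by [p] leaves [c ^+ 2 * q] for the potentials, which
   enter squared, and [c * q] for the forces, which do not. *)
pose e := Num.min (c ^+ 2) c / p%:R.
have e0 : 0 < e by rewrite divr_gt0// lt_min exprn_gt0.
have [x [xI [u]]] : exists x : 'I_p -> 'rV[R]_m, injective x /\ exists u : 'cV[R]_p,
   \sum_(i < p) `| \sum_(j < p | j != i) u j 0 / enorm (x i - x j) | ^+ 2
      + 2 * sup (range (fun i : 'I_p =>
          enorm (\sum_(j < p | j != i)
            (u i 0 * u j 0 / enorm (x i - x j) ^+ 3) *: (x i - x j))))
      < e * \sum_(i < p) \sum_(j < p | j != i)
               u j 0 ^+ 2 / enorm (x i - x j) ^+ 2.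
  apply: contrapT => H; apply: nBX; exists e => // x xI u.
  by rewrite leNgt; apply/negP => lt; apply: H; exists x; split => //; exists u.
set F1 := \sum_(i < p) `|_| ^+ 2; set f := (fun i : 'I_p => enorm _) => lt.
have [s [si smin]] := exists_nearest x p1.
pose d i := enorm (x i - x (s i)).
have r0 i j : j != i -> 0 < enorm (x i - x j).
  by move=> ji; rewrite enorm_gt0 subr_eq0 (inj_eq xI) eq_sym.
have d0 i : 0 < d i by apply: r0.
have f0 i : 0 <= f i by exact: enorm_ge0.
have F10 : 0 <= F1 by apply: sumr_ge0 => i _; exact: sqr_ge0.
have fsup i : f i <= sup (range f).
  apply: ub_le_sup; last by exists i.
  exists (\sum_i f i) => _ [j _ <-].
  by rewrite (bigD1 j)//= lerDl sumr_ge0.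
have sup0 : 0 <= sup (range f) by exact: le_trans (fsup (Ordinal p1)).
pose q := \sum_j (u j 0 / d j) ^+ 2.
have q_ge0 : 0 <= q by apply: sumr_ge0 => j _; exact: sqr_ge0.
have lt2 : F1 + 2 * sup (range f) < Num.min (c ^+ 2) c * q.
  apply: lt_le_trans lt _; rewrite /e -mulrA ler_pM2l ?lt_min ?exprn_gt0//.
  rewrite ler_pdivrMl// mulr_natl -[X in q *+ X]card_ord -sumr_const.
  apply: ler_sum => i _; rewrite /q (bigID (fun j => j != i) predT)/=.
  rewrite ler_wpDr ?sumr_ge0// => [j _|]; first exact: sqr_ge0.
  apply: ler_sum => j ji; rewrite expr_div_n ler_wpM2l ?sqr_ge0//.
  rewrite lef_pV2 ?posrE ?exprn_gt0 ?r0//.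
  rewrite ler_pXn2r ?nnegrE ?enorm_ge0// (enormB (x i)).
  by apply: smin; rewrite eq_sym.
have q0 : 0 < q.
  rewrite lt_neqAle q_ge0 andbT eq_sym; apply/eqP => qE.
  move: lt2; rewrite qE mulr0 ltNge => /negP; apply.
  by rewrite addr_ge0// mulr_ge0.
pose t := Num.sqrt q.
have t0 : 0 < t by rewrite sqrtr_gt0.
have t2 : t ^+ 2 = q by rewrite sqr_sqrtr// ltW.
exists x, s, (fun j => u j 0 / d j / t); split => //.
- under eq_bigr do rewrite expr_div_n t2.
  by rewrite -mulr_suml mulfV// gt_eqF.
have minc : Num.min (c ^+ 2) c * q <= c ^+ 2 * q /\ Num.min (c ^+ 2) c * q <= c * q.
  by rewrite !ler_pM2r// !ge_min !lexx orbT.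
split => [i|i k].
  have -> : \sum_(j | j != i) u j 0 / d j / t * (d j / enorm (x i - x j)) =
     (\sum_(j | j != i) u j 0 / enorm (x i - x j)) / t.
    rewrite mulr_suml; apply: eq_bigr => j ji; field.
    by rewrite !gt_eqF// r0.
  rewrite -(@ler_pXn2r _ 2) ?nnegrE ?(ltW c0)// normf_div (gtr0_norm t0).
  rewrite expr_div_n t2 ler_pdivrMr// (le_trans _ minc.1)// (le_trans _ (ltW lt2))//.
  apply: (@le_trans _ _ F1); last by rewrite lerDl mulr_ge0.
  by rewrite /F1 [leRHS](bigD1 i)//= lerDl sumr_ge0// => j _; exact: sqr_ge0.
have -> : u i 0 / d i / t * \sum_(j | j != i) u j 0 / d j / t *
    (d i * d j / enorm (x i - x j) ^+ 3 * (x i - x j) 0 k) =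
   (\sum_(j < p | j != i)
      (u i 0 * u j 0 / enorm (x i - x j) ^+ 3) *: (x i - x j)) 0 k / q.
  rewrite -t2 summxE mulr_suml mulr_sumr; apply: eq_bigr => j ji.
  rewrite [in RHS]mxE; field.
  by rewrite !gt_eqF// r0.
rewrite normf_div (gtr0_norm q0) ler_pdivrMr// (le_trans _ minc.2)//.
rewrite (le_trans (coord_le_enorm _ _))// -/(f i) (le_trans (fsup i))//.
rewrite (le_trans _ (ltW lt2))//; have := sup0; have := F10.
by set S := sup _; set F := F1; lra.
Qed.

End AlmostNull.

(** * Limits along an ultrafilter *)

Section Ultralimits.
Variables (R : realType) (T : Type) (U : set_system T).
Context {UF : UltraFilter U}.

(** The image of [U] under [f] is an ultrafilter containing a compact segment. *)
Lemma ultra_bounded_cvg (f : T -> R) (M : R) :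
  (\forall n \near U, `|f n| <= M) -> exists l : R, f @ U --> l.
Proof.
move=> fM; have := @segment_compact R (- M) M; rewrite compact_ultra => /(_ (f @ U)).
have FU : UltraFilter (f @ U).
  split; first exact: fmap_proper_filter.
  move=> G PG sub; apply/seteqP; split => // A GA.
  have [//|UA] := in_ultra_setVsetC (f @^-1` A) UF.
  have : G (A `&` ~` A) by apply: filterI => //; exact: sub.
  by rewrite setICr => /filter_not_empty.
move=> /(_ FU) []; last by move=> l [_ fl]; exists l.
by apply: filterS fM => n /=; rewrite in_itv /= ler_norml.
Qed.

(** Otherwise each value is avoided on a set of [U], and the intersection of these finitely many
    sets is empty. *)
Lemma ultra_const (I : finType) (f : T -> I) : exists i, \forall n \near U, f n = i.
Proof.
apply: contrapT => H.
have : \forall n \near U, forall i, f n <> i.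
  apply: filter_forall => i.
  by have [Ui|//] := in_ultra_setVsetC [set n | f n = i] UF; case: H; exists i.
by move=> /filter_ex[n /(_ (f n))].
Qed.

Lemma cvg0_of_le (f : T -> R) :
  (forall e : R, 0 < e -> \forall n \near U, `|f n| <= e) -> f @ U --> (0 : R).
Proof. by move=> H; apply/cvgr0Pnorm_le. Qed.

Lemma cvg0_dominated (g f : T -> R) :
  (\forall n \near U, `|f n| <= g n) -> g @ U --> (0 : R) -> f @ U --> (0 : R).
Proof.
move=> fg g0; apply: norm_cvg0.
refine (squeeze_cvgr (f := fun=> 0) (h := g) _ (cvg_cst 0) g0).
by apply: filterS fg => n ->; rewrite normr_ge0.
Qed.

Lemma cvg_sumr (I : Type) (r : seq I) (P : pred I) (f : I -> T -> R) (l : I -> R) :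
  (forall i, P i -> f i @ U --> l i) ->
  (fun n => \sum_(i <- r | P i) f i n) @ U --> \sum_(i <- r | P i) l i.
Proof.
move=> fl; elim: r => [|i r IH].
  by rewrite big_nil; under eq_fun do rewrite big_nil; exact: cvg_cst.
rewrite big_cons; under eq_fun do rewrite big_cons.
by case: ifP => [Pi|_] //; apply: cvgD IH; exact: fl.
Qed.

Lemma ultra_unique (f : T -> R) (a b : R) : f @ U --> a -> f @ U --> b -> a = b.
Proof. exact: (cvg_unique (@Rhausdorff R)). Qed.

Lemma ultra_ler (f g : T -> R) (a b : R) :
  f @ U --> a -> g @ U --> b -> (forall n, f n <= g n) -> a <= b.
Proof.
move=> fa gb fg; rewrite -subr_ge0; apply: (cvgr_to_ge (cvgB gb fa)).
by apply: (@nearW _ U _) => n /=; rewrite subr_ge0.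
Qed.

Lemma cvg_enorm (n : nat) (f : T -> 'rV[R]_n) (l : 'rV[R]_n) :
  (forall k, (fun a => f a 0 k) @ U --> l 0 k) ->
  (fun a => enorm (f a)) @ U --> enorm l.
Proof.
move=> fl; apply: (continuous_cvg _ (@sqrt_continuous R _)).
apply: cvg_sumr => k _; under eq_fun do rewrite expr2; rewrite expr2.
by apply: cvgM; exact: fl.
Qed.

End Ultralimits.

(** * Degenerating sequences of configurations *)

Section Degeneration.
Variables (R : realType) (p m : nat) (T : Type) (U : set_system T).
Context {UF : UltraFilter U}.
Variables (c : T -> R) (x : T -> 'I_p -> 'rV[R]_m) (s : T -> 'I_p -> 'I_p).
Variables (W : T -> 'I_p -> R) (w : 'I_p -> R).
Hypothesis null : forall n, almost_null (c n) (x n) (s n) (W n).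
Hypothesis c0 : c @ U --> (0 : R).
Hypothesis Ww : forall i, W ^~ i @ U --> w i.

Let d n i := enorm (x n i - x n (s n i)).
Let r n i j := enorm (x n i - x n j).
(** A scale-free measure of closeness, at most 1 because neither [d] exceeds [r]. It dominates the
    interactions between points that are not close. *)
Let q i j n := d n i * d n j / r n i j ^+ 2.

Let r_gt0 n i j : j != i -> 0 < r n i j.
Proof.
by move=> ji; case: (null n) => xI *; rewrite enorm_gt0 subr_eq0 (inj_eq xI) eq_sym.
Qed.

Let d_gt0 n i : 0 < d n i.
Proof. by apply: r_gt0; case: (null n). Qed.

Let rC n i j : r n i j = r n j i.
Proof. exact: enormB. Qed.

Let dl n i j : j != i -> d n i <= r n i j.
Proof. by case: (null n) => _ + _ _ _; apply. Qed.

Let dr n i j : j != i -> d n j <= r n i j.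
Proof. by move=> ji; rewrite rC; apply: dl; rewrite eq_sym. Qed.

Let r_tri n i j k : r n i k <= r n i j + r n j k.
Proof. exact: ler_enormB. Qed.

Let W_le1 n i : `|W n i| <= 1.
Proof. exact: almost_null_le1 (null n). Qed.

Let row_cvg0 i :
  (fun n => \sum_(j | j != i) W n j * (d n j / r n i j)) @ U --> (0 : R).
Proof.
apply: cvg0_dominated c0; apply: nearW => n.
by case: (null n) => _ _ _ _ [+ _]; apply.
Qed.

Let grad_cvg0 i k : (fun n => W n i * \sum_(j | j != i)
    W n j * (d n i * d n j / r n i j ^+ 3 * (x n i - x n j) 0 k)) @ U --> (0 : R).
Proof.
apply: cvg0_dominated c0; apply: nearW => n.
by case: (null n) => _ _ _ _ [_ +]; apply.
Qed.

Definition close (i j : 'I_p) : Prop := exists2 K : R, 0 <= K &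
  \forall n \near U, r n i j <= K * d n i /\ r n i j <= K * d n j.

Let close_refl i : close i i.
Proof. by exists 0 => //; apply: nearW => n; rewrite /r subrr enorm0 !mul0r. Qed.

Let close_sym i j : close i j -> close j i.
Proof.
by move=> [K K0 H]; exists K => //; apply: filterS H => n; rewrite rC => -[].
Qed.

(** The distance from [j] to its nearest neighbour is at most its distance to [i]: close points have
    comparable [d]. *)
Let close_le i j n (K : R) : 0 <= K -> r n i j <= K * d n i -> d n j <= (1 + K) * d n i.
Proof.
move=> K0 H; have := d_gt0 n i => d0.
have [->|ji] := eqVneq j i; first by rewrite ler_peMl ?lerDl// ltW.
apply: le_trans (dr n ji) (le_trans H _); rewrite ler_pM2r// lerDr; exact: ler01.
Qed.

Let close_trans i j k : close i j -> close j k -> close i k.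
Proof.
move=> [K K0 H] [L L0 G]; exists (K + L + L * K) => [|].
  by rewrite !addr_ge0// mulr_ge0.
near=> n.
have [h1 h2] : r n i j <= K * d n i /\ r n i j <= K * d n j by near: n.
have [g1 g2] : r n j k <= L * d n j /\ r n j k <= L * d n k by near: n.
have e1 := close_le K0 h1.
have g2' : r n k j <= L * d n k by rewrite rC.
have e2 := close_le L0 g2'.
have t := r_tri n i j k.
have a1 := ler_wpM2l L0 e1.
have a2 := ler_wpM2l K0 e2.
by split; nra.
Unshelve. all: by end_near. Qed.

(** Along an ultrafilter, failure of closeness with constant [e^-1] holds on a set of [U]. There one
    of [d i / r] and [d j / r] is below [e], and the other is at most 1. *)
Let not_close i j : j != i -> ~ close i j -> q i j @ U --> (0 : R).
Proof.
move=> ji nc; apply: cvg0_of_le => e e0.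
have [H|] := in_ultra_setVsetC
    [set n | r n i j <= e^-1 * d n i /\ r n i j <= e^-1 * d n j] UF.
  by exfalso; apply: nc; exists e^-1 => //; rewrite invr_ge0 ltW.
apply: filterS => n /= H; rewrite ger0_norm; last first.
  by rewrite divr_ge0 ?sqr_ge0// mulr_ge0// ltW.
have r0 := r_gt0 n ji; have h1 := dl n ji; have h2 := dr n ji.
have di := d_gt0 n i; have dj := d_gt0 n j.
rewrite /q ler_pdivrMr ?exprn_gt0// expr2 mulrA.
have [a|a] := ltP (e^-1 * d n i) (r n i j).
  by rewrite ler_pM// ?(ltW di) ?(ltW dj)// ltW// -ltr_pdivrMl.
have {}a : e^-1 * d n j < r n i j by rewrite ltNge; apply/negP => b; apply: H.
by rewrite mulrC ler_pM// ?(ltW di) ?(ltW dj)// ltW// -ltr_pdivrMl.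
Qed.

Let cvg_of_sub (f g : T -> R) (l : R) : f @ U --> l ->
  (fun n => g n - f n) @ U --> (0 : R) -> g @ U --> l.
Proof.
move=> fl gf; rewrite -[l]addr0.
have -> : g = (fun n => f n + (g n - f n)) by apply/funext => n; rewrite addrC subrK.
exact: cvgD.
Qed.

(** Moving from [i] to [i'] changes the distance to [j] by at most [K * d n i], so the ratio changes
    by a multiple of [q i j]. Hence a point outside a cluster has the same limit potential on all of
    it. *)
Let ratio_sub i i' j : close i i' -> ~ close i j ->
  (fun n => d n j / r n i j - d n j / r n i' j) @ U --> (0 : R).
Proof.
move=> ii' nij; have [K K0 HK] := ii'.
have ji : j != i by apply: contra_notN nij => /eqP ->.
have ji' : j != i' by apply: contra_notN nij => /eqP ->.
apply: (@cvg0_dominated _ _ _ _ (fun n => (K * (1 + K)) * q i j n)); last first.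
  by rewrite -[0](mulr0 (K * (1 + K))); apply: cvgM; [exact: cvg_cst | exact: not_close].
apply: filterS HK => n [h1 h2].
have [a b] := (r_gt0 n ji, r_gt0 n ji').
have [di dj di'] := And3 (d_gt0 n i) (d_gt0 n j) (d_gt0 n i').
have K1 : 0 < 1 + K by rewrite ltr_pwDl.
have ab : r n i j <= (1 + K) * r n i' j.
  have := r_tri n i i' j; have := ler_wpM2l K0 (dl n ji'); nra.
have sub : `|r n i' j - r n i j| <= K * d n i.
  have := r_tri n i i' j; have := r_tri n i' i j; rewrite (rC n i' i) => t1 t2.
  by rewrite ler_norml; apply/andP; split; lra.
have -> : d n j / r n i j - d n j / r n i' j =
    (r n i' j - r n i j) * (d n j / (r n i j * r n i' j)).
  by field; rewrite !gt_eqF.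
rewrite normrM [X in _ * X]gtr0_norm ?divr_gt0 ?mulr_gt0//.
have -> : K * (1 + K) * q i j n = (K * d n i) * (d n j / (r n i j * (r n i j / (1 + K)))).
  by rewrite /q; field; rewrite !gt_eqF.
apply: ler_pM => //.
  by rewrite divr_ge0 ?mulr_ge0 ?(ltW a) ?(ltW b) ?(ltW dj).
have rK : 0 < r n i j / (1 + K) by rewrite divr_gt0.
rewrite ler_pM2l// lef_pV2 ?posrE ?(mulr_gt0 a b) ?(mulr_gt0 a rK)// ler_pM2l//.
by rewrite ler_pdivrMr// mulrC.
Qed.

Let cluster_limit_eq0 (p0 : nat) (i0 j0 : 'I_p) :
  (forall p', (4 <= p' <= p0)%N -> no_sphere_solution R m p') -> (p <= p0)%N ->
  j0 != i0 -> close i0 j0 -> w i0 = 0.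
Proof.
move=> H pp0 j0i0 cl0.
pose E := [set j | `[< close i0 j >]]%SET.
have inE' j : reflect (close i0 j) (j \in E) by rewrite inE; exact: asboolP.
have ccE i j : i \in E -> j \in E -> close i j.
  by move=> /inE' a /inE' b; apply: close_trans b; exact: close_sym.
have ncE i j : i \in E -> j \notin E -> ~ close i j.
  by move=> /inE' a /inE' b c'; apply: b; exact: close_trans c'.
(* The unit of length is [d n i0]. Closeness bounds the rescaled [d n j] above and, exchanging [i0]
   and [j], away from 0. *)
have [dlt dltP] : exists dlt : 'I_p -> R, forall j, j \in E ->
    0 < dlt j /\ (fun n => d n j / d n i0) @ U --> dlt j.
  apply: (@fin_all_exists _ (fun=> R) (fun j l => j \in E ->
    0 < l /\ (fun n => d n j / d n i0) @ U --> l)) => j.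
  have [/inE' [K K0 HK]|_] := boolP (j \in E); last by exists 0.
  have [|l fl] := @ultra_bounded_cvg _ _ _ _ (fun n => d n j / d n i0) (1 + K).
    apply: filterS HK => n [h _]; rewrite gtr0_norm ?divr_gt0//.
    by rewrite ler_pdivrMr// (close_le K0).
  exists l => _; split => //.
  have K1 : 0 < 1 + K by rewrite ltr_pwDl.
  apply: (@lt_le_trans _ _ (1 + K)^-1); first by rewrite invr_gt0.
  apply: (cvgr_to_ge fl); apply: filterS HK => n [_]; rewrite rC => h.
  by rewrite ler_pdivlMr// ler_pdivrMl// (close_le K0 h).
have [z zP] : exists z : 'I_p -> 'rV[R]_m, forall j, j \in E ->
    forall k, (fun n => (x n j - x n i0) 0 k / d n i0) @ U --> z j 0 k.
  apply: (@fin_all_exists _ (fun=> 'rV[R]_m) (fun j l => j \in E ->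
    forall k, (fun n => (x n j - x n i0) 0 k / d n i0) @ U --> l 0 k)) => j.
  have [/inE' [K K0 HK]|_] := boolP (j \in E); last by exists 0.
  have [f fP] : exists f : 'I_m -> R, forall k,
      (fun n => (x n j - x n i0) 0 k / d n i0) @ U --> f k.
    apply: (@fin_all_exists _ (fun=> R) (fun k l =>
      (fun n => (x n j - x n i0) 0 k / d n i0) @ U --> l)) => k.
    apply: (@ultra_bounded_cvg _ _ _ _ _ K); apply: filterS HK => n [h _].
    rewrite normf_div (gtr0_norm (d_gt0 n i0)) ler_pdivrMr//.
    by apply: le_trans h; rewrite rC; exact: coord_le_enorm.
  by exists (\row_k f k) => _ k; rewrite mxE; exact: fP.
(* These ratios are taken at [i0]; by [ratio_sub] the limits for [j] outside [E] are the same from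
   every point of [E]. *)
have [bet betP] : exists bet : 'I_p -> R, forall j, j != i0 ->
    (fun n => d n j / r n i0 j) @ U --> bet j.
  apply: (@fin_all_exists _ (fun=> R) (fun j l => j != i0 ->
    (fun n => d n j / r n i0 j) @ U --> l)) => j.
  have [_|ji] := eqVneq j i0; first by exists 0.
  have [|l fl] := @ultra_bounded_cvg _ _ _ _ (fun n => d n j / r n i0 j) 1;
    last by exists l.
  apply: nearW => n; have rj := r_gt0 n ji; rewrite gtr0_norm ?divr_gt0//.
  by rewrite ler_pdivrMr// mul1r dr.
have diffP i j k : i \in E -> j \in E ->
    (fun n => (x n i - x n j) 0 k / d n i0) @ U --> (z i - z j) 0 k.
  move=> iE jE; rewrite !mxE.
  have -> : (fun n => (x n i - x n j) 0 k / d n i0) = (fun n =>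
    (x n i - x n i0) 0 k / d n i0 - (x n j - x n i0) 0 k / d n i0).
    by apply/funext => n; rewrite !mxE -mulrBl; congr (_ / _); ring.
  by apply: cvgB; exact: zP.
have rhoP i j : i \in E -> j \in E ->
    (fun n => r n i j / d n i0) @ U --> enorm (z i - z j).
  move=> iE jE.
  have -> : (fun n => r n i j / d n i0) =
      (fun n => enorm ((d n i0)^-1 *: (x n i - x n j))).
    by apply/funext => n; rewrite enormZ gtr0_norm ?invr_gt0// mulrC.
  apply: cvg_enorm => k.
  have -> : (fun n => ((d n i0)^-1 *: (x n i - x n j)) 0 k) =
      (fun n => (x n i - x n j) 0 k / d n i0).
    by apply/funext => n; rewrite mxE mulrC.
  exact: diffP.
(* The limit points stay apart because [r n i j >= d n j] and the rescaled [d n j] has a positive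
   limit. *)
have rho_gt0 i j : i \in E -> j \in E -> j != i -> 0 < enorm (z i - z j).
  move=> iE jE ji; have [dl0 dlP] := dltP j jE; apply: (lt_le_trans dl0).
  apply: (ultra_ler dlP (rhoP i j iE jE)) => n.
  by rewrite ler_pM2r ?invr_gt0// dr.
have zI : {in E &, injective z}.
  move=> i j iE jE e; apply/eqP; apply: contraT => ij.
  by have := rho_gt0 j i jE iE ij; rewrite e subrr enorm0 ltxx.
have i0E : i0 \in E by apply/inE'/close_refl.
(* In the unit [d n i0] the original weight [W j * d j] tends to [w j * dlt j]. The total potential
   tends to 0, so the points of [E] contribute the opposite of the outside sum. *)
pose u j := if j \in E then w j * dlt j else 0.
pose t := - \sum_(j | j \notin E) w j * bet j.
suff u0 : forall i, u i = 0.
  have := u0 i0; rewrite /u i0E => /eqP; rewrite mulf_eq0.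
  by have [/gt_eqF -> _] := dltP _ i0E; rewrite orbF => /eqP.
apply: (@cluster_weights_eq0 R m p0 _ z u t E) => //.
- by move=> j /negbTE jE; rewrite /u jE.
- move=> i iE.
  pose L j := w j * (if j \in E then dlt j / enorm (z i - z j) else bet j).
  have : \sum_(j | j != i) L j = 0.
    apply: ultra_unique (row_cvg0 i); apply: cvg_sumr => j ji; apply: cvgM => //.
    case: ifP => jE; last first.
      have ji0 : j != i0 by apply: contraFneq jE => ->.
      apply: (cvg_of_sub (betP j ji0)); apply: ratio_sub; first exact: ccE.
      by apply: (ncE i); rewrite ?jE.
    have -> : (fun n => d n j / r n i j) =
        (fun n => (d n j / d n i0) * (r n i j / d n i0)^-1).
      by apply/funext => n; field; rewrite !gt_eqF// r_gt0.
    apply: cvgM; first by have [] := dltP j jE.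
    by apply: cvgV (rhoP i j iE jE); rewrite gt_eqF// rho_gt0.
  rewrite (bigID (mem E))/= => /eqP; rewrite addr_eq0 => /eqP e.
  rewrite /potential (bigID (mem E))/= [X in _ + X]big1 ?addr0; last first.
    by move=> j /andP[_ /negbTE jE]; rewrite /u jE mul0r.
  transitivity (\sum_(j | (j != i) && (j \in E)) L j).
    by apply: eq_bigr => j /andP[_ jE]; rewrite /L /u jE mulrA.
  rewrite e; congr (- _); apply: eq_big => [j|j /andP[_ /negbTE jE]].
    by rewrite andb_idl// => jE; apply: contraNneq jE => ->.
  by rewrite /L jE.
- move=> i iE; rewrite {1}/u iE mulf_eq0 negb_or => /andP[wi _].
  apply/rowP => k; rewrite mxE.
  pose M j := w j * (if j \in E
    then dlt i * dlt j / enorm (z i - z j) ^+ 3 * (z i - z j) 0 k else 0).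
  have : w i * \sum_(j | j != i) M j = 0.
    apply: ultra_unique (grad_cvg0 i k); apply: cvgM => //.
    apply: cvg_sumr => j ji; apply: cvgM => //.
    (* For [j] outside [E] the coefficient is at most [q i j] in absolute value. *)
    case: ifP => jE; last first.
      have := not_close ji (ncE i j iE (negbT jE)); apply: cvg0_dominated.
      apply: nearW => n; have rij := r_gt0 n ji.
      rewrite normrM gtr0_norm ?divr_gt0 ?mulr_gt0 ?exprn_gt0//.
      have -> : q i j n = d n i * d n j / r n i j ^+ 3 * r n i j.
        by rewrite /q; field; rewrite gt_eqF.
      by rewrite ler_pM2l ?divr_gt0 ?mulr_gt0 ?exprn_gt0// coord_le_enorm.
    have -> : (fun n => d n i * d n j / r n i j ^+ 3 * (x n i - x n j) 0 k) =
        (fun n => (d n i / d n i0) * (d n j / d n i0) *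
           ((r n i j / d n i0) * ((r n i j / d n i0) * (r n i j / d n i0)))^-1 *
           ((x n i - x n j) 0 k / d n i0)).
      by apply/funext => n; field; rewrite !gt_eqF// r_gt0.
    have rij := rhoP i j iE jE.
    apply: cvgM; last exact: diffP.
    apply: cvgM; first by apply: cvgM; [have [] := dltP i iE | have [] := dltP j jE].
    apply: cvgV; first by rewrite gt_eqF// exprn_gt0// rho_gt0.
    by do 2?apply: cvgM => //.
  move=> /eqP; rewrite mulf_eq0 (negbTE wi)/= => /eqP M0.
  have [dli _] := dltP i iE.
  have : dlt i * (force z u i) 0 k = 0.
    rewrite -[RHS]M0 summxE mulr_sumr; apply: eq_bigr => j ji.
    by rewrite mxE /M /u; case: ifP => _; rewrite ?mul0r ?mulr0//; ring.
  by move=> /eqP; rewrite mulf_eq0 gt_eqF//= => /eqP.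
(* If [t] is nonzero, some point lies outside [E], which makes room for the pole among the [p]
   points. *)
- have [_|t0] := eqVneq t 0.
    by rewrite addn0 (leq_trans _ pp0)// -[leqRHS]card_ord max_card.
  rewrite addn1 (leq_trans _ pp0)// -[leqRHS]card_ord -cardsT proper_card//.
  rewrite properT; apply: contraNneq t0 => ET.
  by rewrite /t ET big1 ?oppr0// => j; rewrite inE.
- by apply/card_gt1P; exists j0, i0; split => //; apply/inE'.
Qed.

Lemma almost_null_limit_false (p0 : nat) :
  (forall p', (4 <= p' <= p0)%N -> no_sphere_solution R m p') ->
  (p <= p0)%N -> False.
Proof.
move=> H pp0.
have w2 : \sum_i w i ^+ 2 = 1.
  apply: (@ultra_unique _ _ U _ (fun n => \sum_i W n i ^+ 2)); last first.
    have -> : (fun n => \sum_i W n i ^+ 2) = (fun=> 1); last exact: cvg_cst.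
    by apply/funext => n; case: (null n).
  apply: cvg_sumr => i _; under eq_fun do rewrite expr2; rewrite expr2.
  exact: cvgM.
have [j1 wj1] : exists j, w j != 0.
  apply/existsP; apply: contraT; rewrite negb_exists => /forallP w0.
  move: w2; rewrite big1 => [/esym/eqP|i _]; first by rewrite oner_eq0.
  by have /negPn/eqP -> := w0 i; rewrite expr0n.
have alone k l : w k != 0 -> l != k -> ~ close k l.
  by move=> /eqP wk lk kl; apply: wk; exact: (cluster_limit_eq0 H pp0 lk kl).
(* The minimising index may depend on [n]; [ultra_const] fixes it along [U], and below likewise the
   nearest neighbour [i] of [j]. *)
have [j [wj jmin]] : exists j, w j != 0 /\
    \forall n \near U, forall k, w k != 0 -> d n j <= d n k.
  have [j jP] := ultra_const (fun n => [arg min_(k < j1 | w k != 0) d n k]%O).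
  have minP n := @Order.TotalTheory.arg_minP _ R _ j1 (fun k => w k != 0) (d n) wj1.
  exists j; split; first by have [n <-] := filter_ex jP; case: (minP n).
  by apply: filterS jP => n <- k wk; case: (minP n) => l _; apply.
have [i iP] := ultra_const (s ^~ j).
have ij : i != j by have [n <-] := filter_ex iP; case: (null n).
have ji : j != i by rewrite eq_sym.
have rji : \forall n \near U, r n j i = d n j by apply: filterS iP => n <-.
(* In the difference of the potentials at [i] and [j] only the term [w j] survives:
   since [d_j] is minimal, any [k] with a nonzero weight contributes at most
   [2 q k j]. *)
suff : (fun n => \sum_(k | k != i) W n k * (d n k / r n i k) -
                 \sum_(k | k != j) W n k * (d n k / r n j k)) @ U --> w j.
  move=> wjP; case/eqP: wj; rewrite -(subr0 0).
  exact: ultra_unique wjP (cvgB (row_cvg0 i) (row_cvg0 j)).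
have -> : (fun n => \sum_(k | k != i) W n k * (d n k / r n i k) -
                 \sum_(k | k != j) W n k * (d n k / r n j k)) =
  (fun n => W n j * (d n j / r n i j) + (- (W n i * (d n i / r n j i)) +
     \sum_(k | (k != i) && (k != j)) W n k * (d n k / r n i k - d n k / r n j k))).
  apply/funext => n; rewrite (bigD1 j)//= [in X in _ - X](bigD1 i)//=.
  rewrite opprD -!addrA; congr (_ + _); rewrite addrCA; congr (_ + _).
  rewrite (eq_bigl (fun k => (k != j) && (k != i))); last first.
    by move=> k; exact: andbC.
  rewrite -sumrB (eq_bigl (fun k => (k != i) && (k != j))); last first.
    by move=> k; exact: andbC.
  by apply: eq_bigr => k _; rewrite mulrBr.
rewrite -[w j]addr0; apply: cvgD.
  rewrite -[w j]mulr1; apply: cvgM => //.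
  apply: (@cvg_of_sub (fun=> 1)); first exact: cvg_cst.
  apply: (@cvg0_dominated _ _ _ _ (fun=> 0)); last exact: cvg_cst.
  apply: filterS rji => n e; rewrite rC e mulfV ?gt_eqF//.
  by rewrite subrr normr0.
have A : (fun n => W n i * (d n i / r n j i)) @ U --> (0 : R).
  have [wi|wi] := eqVneq (w i) 0.
    apply: (@cvg0_dominated _ _ _ _ (fun n => `|W n i|)); last first.
      have := cvg_norm (@Ww i); rewrite wi normr0. exact.
    apply: nearW => n; rewrite normrM ler_piMr// gtr0_norm ?divr_gt0 ?(r_gt0 n ij)//.
    by rewrite ler_pdivrMr ?(r_gt0 n ij)// mul1r dr.
  (* As [r n j i = d n j], the ratio [d n i / r n j i] is exactly [q i j n]. *)
  have := not_close ji (alone _ _ wi ji); apply: cvg0_dominated.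
  apply: filterS rji => n e; rewrite /q (rC n i j) e expr2.
  rewrite -mulf_div mulfV ?gt_eqF// mulr1.
  rewrite normrM [X in _ * X]gtr0_norm ?divr_gt0//.
  by rewrite ler_piMl// divr_ge0 ?(ltW (d_gt0 _ _)).
suff : (fun n => \sum_(k | (k != i) && (k != j))
    W n k * (d n k / r n i k - d n k / r n j k)) @ U -->
    (\sum_(k | (k != i) && (k != j)) 0 : R).
  by rewrite big1_eq => B; have := cvgD (cvgN A) B; rewrite oppr0 addr0; exact.
apply: cvg_sumr => k /andP[ki kj].
have [wk|wk] := eqVneq (w k) 0.
  apply: (@cvg0_dominated _ _ _ _ (fun n => `|W n k|)); last first.
    have := cvg_norm (@Ww k); rewrite wk normr0. exact.
  apply: nearW => n; rewrite normrM ler_piMr//.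
  have ratio l : k != l -> 0 <= d n k / r n l k <= 1.
    move=> kl; have rlk := r_gt0 n kl.
    by rewrite divr_ge0 ?(ltW (d_gt0 _ _)) ?(ltW rlk)//= ler_pdivrMr// mul1r dr.
  have /andP[a1 a2] := ratio i ki; have /andP[b1 b2] := ratio j kj.
  by rewrite ler_norml; apply/andP; split; lra.
have jk : j != k by rewrite eq_sym.
apply: (@cvg0_dominated _ _ _ _ (fun n => 2 * q k j n)); last first.
  rewrite -[0](mulr0 2); apply: cvgM; first exact: cvg_cst.
  exact: not_close jk (alone _ _ wk jk).
near=> n.
have e : r n j i = d n j by near: n.
have djk : d n j <= d n k by near: n; apply: filterS jmin => n; apply.
have [a b] := (r_gt0 n ki, r_gt0 n kj).
rewrite normrM (le_trans (ler_piMl _ (W_le1 n k)))//.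
have -> : d n k / r n i k - d n k / r n j k =
    (r n j k - r n i k) * (d n k / (r n i k * r n j k)).
  by field; rewrite !gt_eqF.
rewrite normrM [X in _ * X]gtr0_norm ?divr_gt0 ?(mulr_gt0 a b)//.
have -> : 2 * q k j n = d n j * (d n k / (r n j k / 2 * r n j k)).
  by rewrite /q (rC n k j); field; rewrite gt_eqF.
have t1 := r_tri n j i k; have t2 := r_tri n i j k.
rewrite e in t1; rewrite (rC n i j) e in t2.
(* Minimality of [d n j] enters here: [r n j k <= d n j + r n i k <= 2 * r n i k], as
   [d n j <= d n k <= r n i k]. This is the source of the factor 2. *)
have dik := dr n ki.
apply: ler_pM => //.
- by rewrite divr_ge0 ?(ltW (d_gt0 _ _)) ?(ltW (mulr_gt0 a b)).
- by rewrite ler_norml; apply/andP; split; lra.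
have b2 : 0 < r n j k / 2 by rewrite divr_gt0.
rewrite ler_pM2l// lef_pV2 ?posrE ?(mulr_gt0 a b) ?(mulr_gt0 b2 b)// ler_pM2r//.
by rewrite ler_pdivrMr//; lra.
Unshelve. all: by end_near. Qed.

End Degeneration.

(** * From the sphere to the inequality *)

Section SphereToBX.
Variables (R : realType) (m : nat).

Lemma BX_of_no_sphere_solution (p0 p : nat) :
  (forall p', (4 <= p' <= p0)%N -> no_sphere_solution R m p') ->
  (1 < p <= p0)%N -> BX_inequality R p m.
Proof.
move=> H /andP[p1 pp0]; apply: contrapT => nBX.
pose c (n : nat) : R := n.+1%:R^-1.
have ex n : exists a : ('I_p -> 'rV[R]_m) * ('I_p -> 'I_p) * ('I_p -> R),
    almost_null (c n) a.1.1 a.1.2 a.2.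
  have cn : 0 < c n by rewrite invr_gt0.
  by have [x [s [W null]]] := exists_almost_null p1 nBX cn; exists (x, s, W).
have [a null] := choice ex.
(* The ultrafilter refines the filter of cofinite sets, so the sequence [c] still tends to 0 along
   it. *)
have [U [UF sub]] := ultraFilterLemma eventually_filter.
have c0 : c @ U --> (0 : R).
  by move=> A A0; apply: sub; exact: cvg_harmonic.
have [w Ww] : exists w : 'I_p -> R, forall i, (fun n => (a n).2 i) @ U --> w i.
  apply: (@fin_all_exists _ (fun=> R) (fun i l => (fun n => (a n).2 i) @ U --> l)) => i.
  apply: (@ultra_bounded_cvg _ _ _ _ _ 1); apply: nearW => n.
  exact: almost_null_le1 (null n).
exact: (almost_null_limit_false null c0 Ww H pp0).
Qed.

End SphereToBX.

Theorem theorem1p2 (R : realType) (m p0 : nat)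
    (hm : (1 <= m)%N) (hp0 : (4 <= p0)%N) :
  (forall p : nat, (4 <= p <= p0)%N -> BX_inequality R p m) <->
  (forall p : nat, (4 <= p <= p0)%N ->
     forall y : 'I_p -> 'rV[R]_m.+1,
       (forall i : 'I_p, unit_sphere R m (y i)) -> injective y ->
       ~ (exists v : 'cV[R]_p, v <> 0 /\ sphere_system y v)).
Proof.
split => [BX p p4|H p p4].
  apply: no_sphere_solution_of_BX (BX p p4) => //.
  by case/andP: p4 => p4 _; apply: leq_trans p4.
apply: (@BX_of_no_sphere_solution R m p0) => //.
by case/andP: p4 => p4 ->; rewrite (leq_trans _ p4).
Qed.
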